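(* Let $\mathbb{F}$ be a field and let $\mathcal{W}$ be a subspace of $\mathbb{F}^{n}$. Every basis of $\mathcal{W}$ has exactly the same number of elements as the red basis of $\mathcal{W}$.
   Context: $\mathbb{F}$ is an arbitrary field. A basis (coordinate system) of a subspace $\mathcal{W}$ is a list $X_1,\ldots,X_m$ in $\mathcal{W}$ such that every element of $\mathcal{W}$ can be expressed uniquely as a linear combination of $X_1,\ldots,X_m$. A non-zero vector $X\in\mathbb{F}^n$ terminates in the $j$-th position if its last non-zero entry is in the $j$-th position. An index $j$ is a red index of $\mathcal{W}$ (and the $j$-th position is a red position) if $\mathcal{W}$ contains an element that terminates in the $j$-th position. For each red index $i$ of $\mathcal{W}$, the red-basic element $W_i$ is the (unique, existing) element of $\mathcal{W}$ that terminates with a $1$ in the $i$-th position and has $0$'s in all preceding red positions of $\mathcal{W}$. The red basis of $\mathcal{W}$ is the basis formed by the red-basic elements of $\mathcal{W}$, listed in the order of the corresponding red indices; its number of elements is the number of red indices of $\mathcal{W}$ (the red-imension of $\mathcal{W}$). *)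

(* Defs.v *)
From HB Require Import structures.
From mathcomp Require Import all_boot all_order all_algebra.
From mathcomp Require Import boolp classical_sets.
Set Implicit Arguments.
Unset Strict Implicit.
Unset Printing Implicit Defensive.
Import GRing.Theory.
Local Open Scope ring_scope.

Section Bases.
Variables (F : fieldType) (n : nat).
Implicit Types (W : {vspace 'rV[F]_n}) (w : 'rV[F]_n) (i j : 'I_n).

(* The library's [basis_of] is not used: it rests on [free X], which is defined
   by [\dim <<X>> = size X] and thus presupposes the invariance of dimension.
   The coefficients are a finite function, so that [exists!] is uniqueness of
   the coefficient family itself. *)
Definition is_basis W (X : seq 'rV[F]_n) : Prop :=
  {subset X <= W} /\
  forall w, w \in W ->
    exists! c : {ffun 'I_(size X) -> F}, w = \sum_(k < size X) c k *: X`_k.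

Definition terminates w j : bool :=
  (w ord0 j != 0) && [forall k : 'I_n, (j < k)%N ==> (w ord0 k == 0)].

Definition red_index W j : Prop := exists2 w, w \in W & terminates w j.

Definition red_basic W i w : Prop :=
  [/\ w \in W, terminates w i, w ord0 i = 1 &
      forall j, (j < i)%N -> red_index W j -> w ord0 j = 0].

(* The default value [0] is never returned at a red index, see [red_basicP]. *)
Definition red_elt W i : 'rV[F]_n := xget 0 [set w | red_basic W i w].

Definition red_indices W : seq 'I_n := [seq i <- enum 'I_n | `[< red_index W i >]].

(* [enum 'I_n] is increasing, hence so are the indices listed here. *)
Definition red_basis W : seq 'rV[F]_n := [seq red_elt W i | i <- red_indices W].

Lemma terminatesP w j :
  reflect (w ord0 j <> 0 /\ forall k : 'I_n, (j < k)%N -> w ord0 k = 0)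
          (terminates w j).
Proof.
apply: (iffP andP) => [[/eqP wj /forallP wk]|[/eqP wj wk]]; split=> //.
  by move=> k jk; apply/eqP; have /implyP := wk k; apply.
by apply/forallP => k; apply/implyP => /wk ->.
Qed.

Lemma terminates_ex w : w != 0 -> exists j, terminates w j.
Proof.
move=> w0; have [j0 wj0] : exists j, w ord0 j != 0.
  by have /rV0Pn := w0.
case: (arg_maxnP (P := fun j => w ord0 j != 0) (fun j => j : nat) wj0) => j wj jmax.
exists j; apply/terminatesP; split; first exact/eqP.
move=> k jk; apply/eqP; apply: contraTT jk => /jmax kj.
by rewrite -leqNgt.
Qed.

Lemma red_basicP W i : red_index W i -> exists! w, red_basic W i w.
Proof.
move=> [x xW /terminatesP[xi xk]].
have [w Bw] : exists w, red_basic W i w.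
  suff H m : exists w, [/\ w \in W, terminates w i, w ord0 i = 1 &
      forall j, (i - m <= j < i)%N -> red_index W j -> w ord0 j = 0].
    have [w [wW wt wi wj]] := H i; exists w; split=> // j ji.
    by apply: wj; rewrite subnn.
  elim: m => [|m [w [wW wt wi wj]]].
    exists ((x ord0 i)^-1 *: x); split.
    - exact: memvZ.
    - apply/terminatesP; rewrite mxE mulVf; last exact/eqP.
      by split=> [|k /xk xk0]; [exact/eqP/oner_neq0 | rewrite mxE xk0 mulr0].
    - by rewrite mxE mulVf //; exact/eqP.
    - by move=> j; rewrite subn0 => /andP[/leq_ltn_trans h /h]; rewrite ltnn.
  have [im|mi] := leqP i m.
    exists w; split=> // j /andP[_ ji]; apply: wj.
    by move: im; rewrite -subn_eq0 => /eqP ->.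
  have pi : (i - m.+1 < i)%N by rewrite ltn_subrL (leq_ltn_trans (leq0n m) mi).
  pose p := Ordinal (ltn_trans pi (ltn_ord i)).
  have pS : p.+1 = (i - m)%N by rewrite /= -subSn.
  have [[y yW /terminatesP[yp yk]]|np] := pselect (red_index W p); last first.
    exists w; split=> // j /andP[]; rewrite -[(i - _)%N]/(p : nat) leq_eqVlt => /orP[/eqP pj _ |pj ji].
      by rewrite (_ : j = p) //; exact/val_inj.
    by apply: wj; rewrite -pS pj.
  pose z := w - (w ord0 p / y ord0 p) *: y.
  have zk (k : 'I_n) : (p < k)%N -> z ord0 k = w ord0 k.
    by move=> /yk yk0; rewrite !mxE yk0 mulr0 subr0.
  exists z; split.
  - by rewrite memvB ?memvZ.
  - have /terminatesP[wi0 wk] := wt; apply/terminatesP; rewrite zk //.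
    by split=> // k ik; rewrite zk ?wk // (ltn_trans pi).
  - by rewrite zk.
  - move=> j /andP[]; rewrite -[(i - _)%N]/(p : nat) leq_eqVlt => /orP[/eqP pj _ _|pj ji rj].
      rewrite (_ : j = p); last exact/val_inj.
      by rewrite !mxE divfK ?subrr //; exact/eqP.
    by rewrite zk // wj // -pS pj.
exists w; split=> // v [vW /terminatesP[_ vk] vi vj].
have [wW /terminatesP[_ wk] wi wj] := Bw.
apply/eqP; rewrite -subr_eq0; apply/negPn/negP => /terminates_ex[j tj].
have rj : red_index W j by exists (w - v); rewrite ?memvB.
have /terminatesP[+ _] := tj; apply; rewrite !mxE.
case: (ltngtP j i) => [ji|ij|/val_inj ->].
- by rewrite wj // vj // subrr.
- by rewrite wk // vk // subrr.
- by rewrite wi vi subrr.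
Qed.

Lemma red_eltP W i : red_index W i -> red_basic W i (red_elt W i).
Proof. by move=> /red_basicP[w [Bw _]]; apply: (xgetPex 0 (P := red_basic W i)); exists w. Qed.

End Bases.

(* Main.v *)
Require Import Defs.
From mathcomp Require Import all_boot all_order all_algebra.
From mathcomp Require Import boolp.
Import GRing.Theory.
Local Open Scope ring_scope.

(** The red-basic elements of [W] are biorthogonal to the red coordinates: the
    red-basic element of index [i] has entry [1] in position [i] and [0] in
    every other red position. Reading off the red coordinates of a linear
    combination of red-basic elements thus returns its coefficients, which gives
    linear independence ([free_red_basis]). The red coordinates also determine an
    element of [W], since a non-zero element terminates in a red position
    ([red_coord_inj]); so every [w] in [W] is the combination of the red-basic
    elements whose coefficients are the red coordinates of [w], which gives
    spanning ([red_decomposition]).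

    Hence the red basis is a free family spanning [W]. So is every list in which
    the elements of [W] have unique coordinates ([is_basis_basis_of]): uniqueness
    for the zero vector is linear independence. Any two free families with the
    same span have the same length, namely the dimension of [W]. *)

Lemma is_basis_basis_of (F : fieldType) (n : nat) (W : {vspace 'rV[F]_n})
    (X : seq 'rV[F]_n) : is_basis W X -> basis_of W X.
Proof.
move=> [XW XP]; apply/andP; split.
  rewrite eqEsubv; apply/andP; split; first exact/span_subvP.
  apply/subvP => w /XP[c [-> _]]; apply: memv_suml => k _.
  by rewrite memvZ // memv_span // mem_nth.
apply/(@freeP _ _ _ (in_tuple X)) => c c0 k.
have [d [_ dP]] := XP 0 (mem0v W).
have dc : d = finfun c.
  by apply: dP; rewrite -[LHS]c0; apply: eq_bigr => i _; rewrite ffunE.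
have d0 : d = [ffun=> 0].
  by apply: dP; rewrite big1 // => i _; rewrite ffunE scale0r.
by have /ffunP/(_ k) := etrans (esym dc) d0; rewrite !ffunE.
Qed.

Section RedBasis.
Variables (F : fieldType) (n : nat) (W : {vspace 'rV[F]_n}).

Lemma mem_red_indices i : reflect (red_index W i) (i \in red_indices W).
Proof. by rewrite mem_filter mem_enum andbT; exact: asboolP. Qed.

Lemma red_indices_uniq : uniq (red_indices W).
Proof. exact/filter_uniq/enum_uniq. Qed.

(** Before position [i] the entry vanishes because [red_elt W i] is red-basic,
    after it because [red_elt W i] terminates there. *)
Lemma red_elt_coord i j : red_index W i -> red_index W j ->
  red_elt W i ord0 j = (i == j)%:R.
Proof.
move=> /red_eltP[_ /terminatesP[_ after] at_i before] rj.
have [<- // | neq_ij] := eqVneq i j.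
have [lt_ij | lt_ji | /val_inj eq_ij] := ltngtP i j.
- exact: after.
- exact: before.
- by rewrite eq_ij eqxx in neq_ij.
Qed.

(** The difference of two elements that agree in all red positions cannot
    terminate anywhere. *)
Lemma red_coord_inj v w : v \in W -> w \in W ->
  (forall j, red_index W j -> v ord0 j = w ord0 j) -> v = w.
Proof.
move=> vW wW vw; apply/eqP; rewrite -subr_eq0; apply/negPn/negP.
move=> /terminates_ex[j tj].
have rj : red_index W j by exists (v - w); rewrite ?memvB.
by have /terminatesP[+ _] := tj; apply; rewrite !mxE vw ?subrr.
Qed.

Lemma red_combination_coord (c : 'I_n -> F) j : red_index W j ->
  (\sum_(i <- red_indices W) c i *: red_elt W i) ord0 j = c j.
Proof.
move=> rj; have jR : j \in red_indices W by apply/mem_red_indices.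
rewrite summxE (bigD1_seq j) ?red_indices_uniq //= mxE red_elt_coord // eqxx.
rewrite mulr1 big_seq_cond big1 ?addr0 // => i /andP[/mem_red_indices ri ij].
by rewrite mxE red_elt_coord // (negbTE ij) mulr0.
Qed.

Lemma red_decomposition w : w \in W ->
  w = \sum_(i <- red_indices W) w ord0 i *: red_elt W i.
Proof.
move=> wW; apply: red_coord_inj => // [|j rj].
  rewrite big_seq; apply: memv_suml => i /mem_red_indices /red_eltP[eW _ _ _].
  exact: memvZ.
by rewrite red_combination_coord.
Qed.

Lemma free_red_basis : free (red_basis W).
Proof.
apply/(@freeP _ _ _ (in_tuple (red_basis W))) => c c0 k.
have sizeR : size (red_basis W) = size (red_indices W) by rewrite size_map.
have ltR (l : 'I_(size (red_basis W))) : (l < size (red_indices W))%N.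
  by rewrite -sizeR.
(* [j0] serves only as the default of [nth]; it exists since [k] does. *)
have [j0 _] : exists j0 : 'I_n, true.
  by have := ltR k; case: (red_indices W) => // j0; exists j0.
pose idx (l : 'I_(size (red_basis W))) := nth j0 (red_indices W) l.
have red_idx l : red_index W (idx l) by apply/mem_red_indices/mem_nth.
have basisE (l : 'I_(size (red_basis W))) : (red_basis W)`_l = red_elt W (idx l).
  by rewrite (nth_map j0).
have /(congr1 (fun w : 'rV_n => w ord0 (idx k))) := c0.
rewrite summxE (bigD1 k) //= big1 => [|l lk].
  by rewrite !mxE basisE red_elt_coord // eqxx mulr1 addr0.
rewrite mxE basisE red_elt_coord // nth_uniq ?red_indices_uniq //.
by rewrite val_eqE (negbTE lk) mulr0.
Qed.

Lemma red_basis_basis_of : basis_of W (red_basis W).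
Proof.
apply/andP; split; last exact: free_red_basis.
rewrite eqEsubv; apply/andP; split.
  by apply/span_subvP => _ /mapP[i /mem_red_indices /red_eltP[eW _ _ _] ->].
apply/subvP => w /red_decomposition ->; rewrite big_seq.
by apply: memv_suml => i iR; rewrite memvZ // memv_span // map_f.
Qed.

End RedBasis.

Theorem theorem4p4 (F : fieldType) (n : nat) (W : {vspace 'rV[F]_n})
    (X : seq 'rV[F]_n) (hX : is_basis W X) :
  size X = size (red_basis W).
Proof.
have /andP[/eqP spanX /eqP <-] := is_basis_basis_of _ _ _ _ hX.
by have /andP[/eqP spanR /eqP <-] := red_basis_basis_of _ _ W; rewrite spanX spanR.
Qed.
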